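(* Let $G$ be a Lie group with finitely many connected components, $H\subset G$ a closed subgroup, and $X:=G/H$; assume that $X$ admits a nonzero relatively $G$-invariant measure. Let $\rho\colon G\to GL(V)$ be a continuous representation of $G$ on a finite dimensional real vector space $V$ and let $v_0\in V$ be an $H$-fixed vector. Let $\Theta\subset V^\vee\times W_0(G,H)$ and $\mathcal{P}=\{p_\theta\}_{\theta\in\Theta}$ be the parameter set and the family of probability measures on $X$ obtained from $(G,H,V,v_0)$ by the method described in the context. Then $\mathcal{P}$ is $G$-invariant, i.e. $g\cdot p\in\mathcal{P}$ for any $p\in\mathcal{P}$ and $g\in G$. Moreover, the $G$-action on $\Theta$ is given by $$G\times\Theta\to\Theta,\qquad (g,(\varphi,\tau))\mapsto(\rho^\vee(g)\varphi,\tau),$$ where $\rho^\vee$ is the contragredient representation of $\rho$; that is, for all $g\in G$ and $\theta=(\varphi,\tau)\in\Theta$ one has $\theta':=(\rho^\vee(g)\varphi,\tau)\in\Theta$ and $g\cdot p_\theta=p_{\theta'}$.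
   Context: Relatively invariant measures: $G$ acts on the set $\mathcal{R}(X)$ of Radon measures on $X$ by pushforward, $(g\cdot\nu)(B)=\nu(g^{-1}B)$. A measure $\nu\in\mathcal{R}(X)$ is relatively $G$-invariant if there is a map $\chi\colon G\to\mathbb{R}_{>0}$ (the multiplier of $\nu$) with $d(g\cdot\nu)(x)=\chi(g)^{-1}d\nu(x)$ for all $g\in G$. The method: put $W_0(G,H):=\{\tau\colon G\to\mathbb{R}\mid \tau \text{ is a continuous group homomorphism with }\tau|_H=0\}$ and let $V^\vee$ be the dual space of $V$. Take a nonzero relatively $G$-invariant measure $\nu$ on $X=G/H$ (the family below does not depend on the choice of $\nu$). For $\theta=(\varphi,\tau)\in V^\vee\times W_0(G,H)$ and $x=gH\in X$, set $\rho(x)v_0:=\rho(g)v_0$ and $\tau(x):=\tau(g)$ (well-defined since $v_0$ is $H$-fixed and $\tau|_H=0$) and $$d\tilde p_\theta(x):=\exp(-\langle\varphi,\rho(x)v_0\rangle+\tau(x))\,d\nu(x).$$ Put $\Theta:=\{\theta\in V^\vee\times W_0(G,H)\mid \int_X d\tilde p_\theta<\infty\}$ and, for $\theta\in\Theta$, $c_\theta:=(\int_X d\tilde p_\theta)^{-1}$ and $p_\theta:=c_\theta\tilde p_\theta$. The family obtained is $\mathcal{P}:=\{p_\theta\}_{\theta\in\Theta}$. The contragredient representation is $\langle\rho^\vee(g)\varphi,v\rangle=\langle\varphi,\rho(g^{-1})v\rangle$. *)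

(* Defs.v *)
From HB Require Import structures.
From mathcomp Require Import all_boot all_order all_algebra.
From mathcomp Require Import all_classical all_reals all_analysis.
From mathcomp Require Import measurable_realfun.
Set Implicit Arguments.
Unset Strict Implicit.
Unset Printing Implicit Defensive.
Import Order.TTheory GRing.Theory Num.Theory.
Import numFieldNormedType.Exports.
Local Open Scope classical_set_scope.
Local Open Scope ring_scope.

(* Meaningful for open U; C^k through iterated partial derivatives. *)
Fixpoint Ck_on (R : realType) (n m k : nat) (U : set 'rV[R]_n)
    (f : 'rV[R]_n -> 'rV[R]_m) : Prop :=
  (forall x, U x -> {for x, continuous f}) /\
  if k is k'.+1 then
    forall i : 'I_n,
      (forall x, U x -> derivable f x (delta_mx 0 i)) /\
      Ck_on k' U (fun x => 'D_(delta_mx 0 i) f x)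
  else True.

Definition smooth_on (R : realType) (n m : nat) (U : set 'rV[R]_n)
    (f : 'rV[R]_n -> 'rV[R]_m) : Prop := forall k, Ck_on k U f.

(* [chart_map] and [chart_inv] are total functions; only their values on
   [chart_dom] and on its image are meaningful. *)
Record chart (R : realType) (n : nat) (M : topologicalType) := Chart {
  chart_dom : set M;
  chart_map : M -> 'rV[R]_n;
  chart_inv : 'rV[R]_n -> M;
  chart_cod := chart_map @` chart_dom;
  chart_dom_open : open chart_dom;
  chart_cod_open : open chart_cod;
  chart_map_continuous : {within chart_dom, continuous chart_map};
  chart_inv_continuous : {within chart_cod, continuous chart_inv};
  chart_mapK : {in chart_dom, cancel chart_map chart_inv}
}.

Definition smooth_atlas (R : realType) (n : nat) (M : topologicalType)
    (A : set (chart R n M)) : Prop :=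
  (forall x : M, exists2 a, A a & chart_dom a x) /\
  forall a b, A a -> A b ->
    smooth_on (chart_map a @` (chart_dom a `&` chart_dom b))
              (chart_map b \o chart_inv a).

HB.mixin Record isTopGroup G & Topological G & Group G := {
  mulg_continuous : continuous (fun xy : G * G => (xy.1 * xy.2)%g);
  invg_continuous : continuous (fun x : G => x^-1%g)
}.

#[short(type="topGroupType")]
HB.structure Definition TopGroup := {G of isTopGroup G & Topological G & Group G}.

HB.mixin Record isLieGroup (R : realType) G & TopGroup G := {
  lie_hausdorff : hausdorff_space G;
  lie_second_countable : @second_countable G;
  lie_dim : nat;
  lie_atlas : set (chart R lie_dim G);
  lie_atlas_smooth : smooth_atlas lie_atlas;
  lie_mul_smooth : forall a b c, lie_atlas a -> lie_atlas b -> lie_atlas c ->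
    smooth_on
      [set z : 'rV[R]_(lie_dim + lie_dim) |
        [/\ chart_cod a (lsubmx z), chart_cod b (rsubmx z) &
            chart_dom c (chart_inv a (lsubmx z) * chart_inv b (rsubmx z))%g]]
      (fun z => chart_map c
                  (chart_inv a (lsubmx z) * chart_inv b (rsubmx z))%g);
  lie_inv_smooth : forall a b, lie_atlas a -> lie_atlas b ->
    smooth_on
      [set z | chart_cod a z /\ chart_dom b (chart_inv a z)^-1%g]
      (fun z => chart_map b (chart_inv a z)^-1%g)
}.

#[short(type="lieGroupType")]
HB.structure Definition LieGroup (R : realType) :=
  {G of isLieGroup R G & TopGroup G}.

Definition finitely_many_components (T : topologicalType) : Prop :=
  finite_set [set connected_component [set: T] x | x in [set: T]].

Record closedSubgroup (G : topGroupType) := ClosedSubgroup {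
  csubg : set G;
  csubg1 : csubg 1%g;
  csubgM : forall x y, csubg x -> csubg y -> csubg (x * y)%g;
  csubgV : forall x, csubg x -> csubg x^-1%g;
  csubg_closed : closed csubg
}.

Section HomogeneousSpace.
Variables (G : topGroupType) (H : closedSubgroup G).

Definition lcoset_rel : rel G := fun x y => `[< csubg H (x^-1 * y)%g >].

Lemma lcoset_rel_refl : reflexive lcoset_rel.
Proof. by move=> x; apply/asboolP; rewrite mulVg; exact: csubg1. Qed.

Lemma lcoset_rel_sym : symmetric lcoset_rel.
Proof.
have imp x y : lcoset_rel x y -> lcoset_rel y x.
  move=> /asboolP Hxy; apply/asboolP.
  by have := csubgV Hxy; rewrite invgM invgK.
by move=> x y; apply/idP/idP; exact: imp.
Qed.

Lemma lcoset_rel_trans : transitive lcoset_rel.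
Proof.
move=> y x z /asboolP Hxy /asboolP Hyz; apply/asboolP.
by have := csubgM Hxy Hyz; rewrite mulgA mulgK.
Qed.

Definition lcoset_equiv :=
  EquivRel lcoset_rel lcoset_rel_refl lcoset_rel_sym lcoset_rel_trans.

Definition homspace : Type := quotient_topology {eq_quot lcoset_equiv}%qT.

HB.instance Definition _ := Topological.on homspace.
HB.instance Definition _ := Quotient.copy homspace
  (quotient_topology {eq_quot lcoset_equiv}%qT).
HB.instance Definition _ := isPointed.Build homspace (\pi_homspace 1%g)%qT.
HB.instance Definition _ := Measurable.copy homspace
  (g_sigma_algebraType (open : set (set homspace))).

Local Notation X := homspace.
Local Notation pi := (\pi_X : G -> X)%qT.

Lemma homspace_piP (x y : G) : pi x = pi y <-> csubg H (x^-1 * y)%g.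
Proof. by split=> [/eqmodP/asboolP//|Hxy]; apply/eqmodP/asboolP. Qed.

Definition gact (g : G) (x : X) : X := pi (g * repr x)%g.

Lemma gact_pi (g a : G) : gact g (pi a) = pi (g * a)%g.
Proof.
apply/homspace_piP; rewrite invgM -mulgA mulKg.
by apply/homspace_piP; rewrite reprK.
Qed.

Lemma gact_continuous (g : G) : continuous (gact g).
Proof.
apply/quotient_continuous.
rewrite (_ : gact g \o _ = pi \o (fun a : G => (g * a)%g)); last first.
  by apply/funext => a /=; rewrite gact_pi.
move=> a; apply: continuous_comp; last exact: pi_continuous.
apply: (@continuous_comp _ _ _ (fun a : G => (g, a)) (fun xy : G * G => (xy.1 * xy.2)%g)).
  by apply: cvg_pair => //; exact: cvg_cst.
exact: mulg_continuous.
Qed.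

Lemma gact_measurable (g : G) : measurable_fun [set: X] (gact g).
Proof.
apply: (@measurability _ _ X X setT (gact g) (@open X)) => //.
move=> _ [B oB <-]; rewrite setTI; apply: sub_sigma_algebra.
by move/continuousP : (gact_continuous (g := g)); apply.
Qed.

Lemma continuous_measurable_homspace (R : realType) (f : X -> R) :
  continuous f -> measurable_fun [set: X] f.
Proof.
move=> /continuousP cf; apply: (measurability _ (RGenOpens.measurableE R)).
move=> _ [_ [a [b ->] <-]]; rewrite setTI; apply: sub_sigma_algebra.
exact/cf/interval_open.
Qed.

End HomogeneousSpace.

Definition meas_eq d (T : measurableType d) (R : realType)
    (m1 m2 : set T -> \bar R) : Prop :=
  forall B, measurable B -> m1 B = m2 B.

Section RelativelyInvariant.
Variables (R : realType) (G : topGroupType) (H : closedSubgroup G).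
Local Notation X := (homspace H).
Local Open Scope ereal_scope.

Definition gmeas (g : G) (nu : set X -> \bar R) : set X -> \bar R :=
  pushforward nu (gact g).

Section gmeas_measure.
Variables (g : G) (nu : {measure set X -> \bar R}).

Let gact_preimage (B : set X) :
  measurable B -> measurable (gact g @^-1` B : set X).
Proof. by move=> mB; rewrite -[X in measurable X]setTI; exact: gact_measurable. Qed.

Let gmeas0 : gmeas g nu set0 = 0.
Proof. by rewrite /gmeas /pushforward preimage_set0 measure0. Qed.

Let gmeas_ge0 B : 0 <= gmeas g nu B.
Proof. by rewrite /gmeas /pushforward measure_ge0. Qed.

Let gmeas_sigma_additive : semi_sigma_additive (gmeas g nu).
Proof.
move=> F mF tF mUF; rewrite /gmeas /pushforward preimage_bigcup.
apply: measure_semi_sigma_additive.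
- by move=> n; exact: gact_preimage.
- apply/trivIsetP => /= i j _ _ ij; rewrite -preimage_setI.
  by move/trivIsetP : tF => /(_ _ _ _ _ ij) ->//; rewrite preimage_set0.
- by rewrite -preimage_bigcup; exact: gact_preimage.
Qed.

HB.instance Definition _ := isMeasure.Build _ _ _ (gmeas g nu)
  gmeas0 gmeas_ge0 gmeas_sigma_additive.

End gmeas_measure.

Definition radon (nu : {measure set X -> \bar R}) : Prop :=
  [/\ forall K : set X, compact K -> nu K < +oo,
      forall B : set X, measurable B ->
        nu B = ereal_inf [set nu U | U in [set U | open U /\ B `<=` U]] &
      forall U : set X, open U ->
        nu U = ereal_sup [set nu K | K in [set K | compact K /\ K `<=` U]]].

Definition relatively_invariant (nu : {measure set X -> \bar R}) : Prop :=
  radon nu /\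
  exists chi : G -> R,
    (forall g, (0 < chi g)%R) /\
    forall g, meas_eq (gmeas g nu) (fun B => ((chi g)^-1)%:E * nu B).

End RelativelyInvariant.

Section Method.
Variables (R : realType) (G : topGroupType) (V : vectType R).

(* A homomorphism into GL(V): the values are invertible by [rep1] and [repM].
   Continuity is that of the matrix entries in a basis, the choice of which is
   immaterial. *)
Record representation := Representation {
  rep :> G -> 'End(V);
  rep1 : rep 1%g = \1%VF;
  repM : forall g h, rep (g * h)%g = (rep g \o rep h)%VF;
  rep_continuous :
    continuous (fun g => passmx.mxof (vbasis {:V}) (vbasis {:V}) (rep g))
}.

Definition contragredient (rho : representation) (g : G)
    (phi : 'Hom(V, R^o)) : 'Hom(V, R^o) :=
  (phi \o rho (g^-1)%g)%VF.

Variable H : closedSubgroup G.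
Local Notation X := (homspace H).
Local Notation pi := (\pi_X : G -> X)%qT.

Record W0 := MkW0 {
  W0_fun :> G -> R;
  W0M : forall g h, W0_fun (g * h)%g = W0_fun g + W0_fun h;
  W0_continuous : continuous W0_fun;
  W0_H : forall h, csubg H h -> W0_fun h = 0
}.

Definition fixed_vector (rho : representation) (v : V) : Prop :=
  forall h, csubg H h -> rho h v = v.

Definition W0_hom (tau : W0) (x : X) : R := tau (repr x).

Definition rep_hom (rho : representation) (v : V) (x : X) : V := rho (repr x) v.

Lemma W0_hom_pi (tau : W0) (g : G) : W0_hom tau (pi g) = tau g.
Proof.
have : csubg H (g^-1 * repr (pi g))%g by apply/homspace_piP; rewrite reprK.
rewrite /W0_hom; set r := repr _ => Hgr.
by rewrite -[r](mulVKg g) W0M (W0_H tau Hgr) addr0.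
Qed.

Lemma rep_hom_pi (rho : representation) (v : V) (g : G) :
  fixed_vector rho v -> rep_hom rho v (pi g) = rho g v.
Proof.
move=> fv.
have : csubg H (g^-1 * repr (pi g))%g by apply/homspace_piP; rewrite reprK.
rewrite /rep_hom; set r := repr _ => Hgr.
by rewrite -[r](mulVKg g) repM lfunE/= fv.
Qed.

Section Family.
Variables (rho : representation) (v0 : V).
Hypothesis fv0 : fixed_vector rho v0.
Variable nu : {measure set X -> \bar R}.
Implicit Type theta : 'Hom(V, R^o) * W0.

Definition density theta (x : X) : R :=
  expR (- theta.1 (rep_hom rho v0 x) + W0_hom theta.2 x).

Lemma rep_coef_continuous (phi : 'Hom(V, R^o)) (v : V) :
  continuous (fun g : G => phi (rho g v) : R).
Proof.
pose e := vbasis {:V}; have eB : basis_of {:V} e := vbasisP _.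
have phiE g : phi (rho g v) = \sum_j \sum_i
    passmx.rVof e v 0 i * passmx.mxof e e (rho g) i j * phi e`_j.
  rewrite -[rho g v](passmx.rVofK eB) (passmx.rVof_app e eB) /passmx.vecof linear_sum/=.
  apply: eq_bigr => j _; by rewrite linearZ/= mxE -mulr_suml.
rewrite (_ : (fun g => _) = fun g => \sum_j \sum_i
    passmx.rVof e v 0 i * passmx.mxof e e (rho g) i j * phi e`_j); last exact/funext.
move=> g; apply: cvg_big => [|j _]; first exact: add_continuous.
apply: cvg_big => [|i _]; first exact: add_continuous.
apply: cvgMl; apply: cvgMr.
apply: (@continuous_comp _ _ _ (fun g => passmx.mxof e e (rho g)) (fun M => M i j)).
  exact: rep_continuous.
exact: coord_continuous.
Qed.

Lemma density_measurable theta : measurable_fun [set: X] (density theta).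
Proof.
apply: continuous_measurable_homspace; apply/quotient_continuous.
rewrite (_ : density theta \o _ =
    fun g => expR (- theta.1 (rho g v0) + theta.2 g)); last first.
  by apply/funext => g /=; rewrite /density rep_hom_pi// W0_hom_pi.
move=> g; apply: continuous_comp; last exact: continuous_expR.
apply: cvgD; last exact: W0_continuous.
by apply: cvgN; exact: rep_coef_continuous.
Qed.

Local Open Scope ereal_scope.

Definition ptilde theta (B : set X) : \bar R :=
  \int[nu]_(x in B) (density theta x)%:E.

Let ptilde0 theta : ptilde theta set0 = 0.
Proof. exact: integral_set0. Qed.

Let ptilde_ge0 theta B : 0 <= ptilde theta B.
Proof. by apply: integral_ge0 => x _; rewrite lee_fin expR_ge0. Qed.

Let ptilde_sigma_additive theta : semi_sigma_additive (ptilde theta).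
Proof.
move=> F mF tF mUF; rewrite /ptilde ge0_integral_bigcup//.
- apply: is_cvg_ereal_nneg_natsum_cond => n _ _.
  by apply: integral_ge0 => x _; rewrite lee_fin expR_ge0.
- apply: measurable_funTS; apply/measurable_EFinP; exact: density_measurable.
- by move=> x _; rewrite lee_fin expR_ge0.
Qed.

HB.instance Definition _ theta := isMeasure.Build _ _ _ (ptilde theta)
  (ptilde0 theta) (ptilde_ge0 theta) (@ptilde_sigma_additive theta).

Definition Theta : set ('Hom(V, R^o) * W0) :=
  [set theta | ptilde theta [set: X] < +oo].

Definition c_ theta : R := (fine (ptilde theta [set: X]))^-1.

Lemma c_ge0 theta : (0 <= c_ theta)%R.
Proof. by rewrite invr_ge0 fine_ge0. Qed.

Definition p_ theta : {measure set X -> \bar R} :=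
  mscale (NngNum (c_ge0 theta)) (ptilde theta).

Lemma p_setT theta : ~ meas_eq nu mzero -> Theta theta -> p_ theta [set: X] = 1.
Proof.
move=> nuN0 Tth.
have nu0 : nu [set: X] != 0.
  apply/eqP => nuT; apply: nuN0 => B mB.
  by apply: (subset_measure0 mB measurableT _ nuT).
rewrite /p_ /= /mscale /= /c_.
have pt0 : ptilde theta setT != 0.
  apply: contra nu0 => /eqP pt0.
  have mf : measurable_fun [set: X] (fun x => (density theta x)%:E).
    by apply/measurable_EFinP; exact: density_measurable.
  have /(ae_eq_integral_abs nu measurableT mf) :
      \int[nu]_(x in setT) `|(density theta x)%:E| = 0.
    rewrite -[RHS]pt0; apply: eq_integral => x _.
    by rewrite gee0_abs// lee_fin expR_ge0.
  move=> [N [mN N0 sN]]; apply/eqP/(subset_measure0 _ mN _ N0) => //.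
  move=> x _; apply: sN => /= /(_ I) [] /eqP; by rewrite gt_eqF// expR_gt0.
have ptf : ptilde theta setT \is a fin_num by rewrite ge0_fin_numE.
by rewrite -[X in _ * X]fineK// -EFinM mulVf// fine_eq0.
Qed.

(* A {measure set X -> \bar R} also carries irrelevant values on non-Borel sets,
   so membership compares measures on Borel sets only. *)
Definition Pfamily : set {measure set X -> \bar R} :=
  [set p | exists2 theta, Theta theta & meas_eq p (p_ theta)].

End Family.
End Method.

(* Main.v *)
(* Writing [theta' = (rho^vee(g) phi, tau)], the density of [ptilde theta] at [x]
   is [exp (- tau g)] times that of [ptilde theta'] at [g x].  With the relative
   invariance of [nu], [g . ptilde theta] is therefore a positive multiple
   [exp (- tau g) / chi g] of [ptilde theta'], and the normalization cancels
   that multiple. *)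

Require Import Defs.
From mathcomp Require Import all_boot all_order all_algebra.
From mathcomp Require Import all_classical all_reals all_analysis.
From mathcomp Require Import measurable_realfun.
Set Implicit Arguments.
Unset Strict Implicit.
Unset Printing Implicit Defensive.
Import Order.TTheory GRing.Theory Num.Theory.
Import numFieldNormedType.Exports.
Local Open Scope classical_set_scope.
Local Open Scope ring_scope.

Lemma gact_preimage_measurable (G : topGroupType) (H : closedSubgroup G) (g : G)
    (B : set (homspace H)) :
  measurable B -> measurable (gact g @^-1` B).
Proof. by move=> mB; rewrite -[X in measurable X]setTI; exact: gact_measurable. Qed.

Section Equivariance.
Variables (R : realType) (G : topGroupType) (H : closedSubgroup G).
Variables (V : vectType R) (rho : representation G V) (v0 : V).
Hypothesis fv0 : fixed_vector H rho v0.
Implicit Types (phi : 'Hom(V, R^o)) (tau : W0 R H).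
Local Notation X := (homspace H).

Lemma W0_hom_gact tau (g : G) (x : X) : W0_hom tau (gact g x) = tau g + W0_hom tau x.
Proof. by rewrite -[x]reprK gact_pi !W0_hom_pi W0M. Qed.

Lemma rep_hom_gact (g : G) (x : X) :
  rep_hom rho v0 (gact g x) = rho g (rep_hom rho v0 x).
Proof. by rewrite -[x]reprK gact_pi !rep_hom_pi// repM lfunE. Qed.

Lemma contragredientE (g : G) phi (v : V) :
  contragredient rho g phi (rho g v) = phi v.
Proof. by rewrite lfunE/= -[rho _ (rho g v)]comp_lfunE -repM mulVg rep1 lfunE. Qed.

(** Moving both [phi] and the orbit point by [g] leaves their pairing unchanged, so only the
    additivity of [tau] leaves a trace, a factor constant in [x]. *)
Lemma density_gact (g : G) phi tau (x : X) :
  density rho v0 (phi, tau) x =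
  expR (- tau g) * density rho v0 (contragredient rho g phi, tau) (gact g x).
Proof.
rewrite /density/= rep_hom_gact contragredientE W0_hom_gact -expRD; congr expR.
by rewrite [RHS]addrCA addKr.
Qed.

Local Open Scope ereal_scope.

(** Change of variables along [gact g]. The factor [k] stands for the inverse multiplier at [g],
    typed as nonnegative so that it can scale a measure. *)
Lemma gmeas_ptilde (nu : {measure set X -> \bar R}) (g : G) (k : {nonneg R}) phi tau :
  meas_eq (gmeas g nu) (fun B => k%:num%:E * nu B) ->
  meas_eq (gmeas g (ptilde rho v0 nu (phi, tau)))
    (fun B => (expR (- tau g) * k%:num)%:E *
              ptilde rho v0 nu (contragredient rho g phi, tau) B).
Proof.
move=> nuE B mB; rewrite /gmeas /pushforward /= /ptilde.
pose f x := (density rho v0 (contragredient rho g phi, tau) x)%:E.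
have mf : measurable_fun [set: X] f.
  by apply/measurable_EFinP; exact: density_measurable.
have f0 x : 0 <= f x by rewrite lee_fin expR_ge0.
under eq_integral do rewrite (density_gact g) EFinM.
rewrite ge0_integralZl_EFin ?expR_ge0//; first last.
- apply: measurable_funTS.
  exact: measurableT_comp mf (gact_measurable g).
- by move=> x _; exact: (f0 (gact g x)).
- exact: gact_preimage_measurable.
rewrite EFinM -muleA; congr (_ * _).
have mfB : measurable_fun B f by exact: measurable_funTS.
(* Both sides become integrals of [f] over [B], one against the pushforward of [nu], the other
   against [k] times [nu]; these measures agree on Borel sets by [nuE]. *)
have /= <- := ge0_integral_pushforward (gact_measurable g) nu mB mfB (fun x _ => f0 x).
rewrite -(ge0_integral_mscale nu mB k mfB)//.
apply: eq_measure_integral => [|? A mA _]; first exact: gact_measurable.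
exact: nuE.
Qed.

Lemma gmeas_p_ (nu : {measure set X -> \bar R}) (g : G) phi tau :
  relatively_invariant nu -> Theta rho v0 nu (phi, tau) ->
  Theta rho v0 nu (contragredient rho g phi, tau) /\
  meas_eq (gmeas g (p_ fv0 nu (phi, tau)))
          (p_ fv0 nu (contragredient rho g phi, tau)).
Proof.
move=> [_ [chi [chi_gt0 nuE]]] Tth.
have chiV_gt0 : (0 < (chi g)^-1)%R by rewrite invr_gt0.
have /= ptE := gmeas_ptilde phi tau (k := NngNum (ltW chiV_gt0)) (nuE g).
set theta' := (contragredient rho g phi, tau) in ptE *.
set k := (_ * _)%R in ptE.
have k_gt0 : (0 < k)%R by rewrite mulr_gt0 ?expR_gt0.
(* The whole space is its own preimage, so the total masses differ by the same factor [k]; as [k] is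
   positive, finiteness passes to [theta']. *)
have ptT : ptilde rho v0 nu (phi, tau) setT = k%:E * ptilde rho v0 nu theta' setT.
  by rewrite -ptE.
have Tth' : Theta rho v0 nu theta'.
  by rewrite /Theta/= -(lte_pmul2l (z := k%:E))// -ptT gt0_muley.
split=> // B mB; rewrite /gmeas /pushforward /= /mscale /=.
have := ptE B mB; rewrite /gmeas /pushforward => ->.
rewrite muleA -EFinM /c_ ptT; congr (_%:E * _).
have ptfin : ptilde rho v0 nu theta' setT \is a fin_num.
  rewrite ge0_fin_numE; first exact: Tth'.
  by apply: integral_ge0 => x _; rewrite lee_fin expR_ge0.
(* With [m] the finite total mass for [theta'], the claim is [(k * m)^-1 * k = m^-1]. Only [k] is
   cancelled; the convention [0^-1 = 0] lets the inverse split for every [m]. *)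
rewrite fineM//=.
by rewrite invfM -mulrA mulrCA mulVf ?mulr1// gt_eqF.
Qed.

End Equivariance.

Theorem proposition3p7 (R : realType) (G : lieGroupType R)
    (Gcomp : finitely_many_components G)
    (H : closedSubgroup G)
    (V : vectType R) (rho : representation G V)
    (v0 : V) (fv0 : fixed_vector H rho v0)
    (nu : {measure set (homspace H) -> \bar R})
    (nu_neq0 : ~ meas_eq nu mzero)
    (nu_relinv : relatively_invariant nu) :
  (forall (p : {measure set (homspace H) -> \bar R}) (g : G),
      Pfamily fv0 nu p -> Pfamily fv0 nu (gmeas g p)) /\
  (forall (g : G) (phi : 'Hom(V, R^o)) (tau : W0 R H),
      Theta rho v0 nu (phi, tau) ->
      Theta rho v0 nu (contragredient rho g phi, tau) /\
      meas_eq (gmeas g (p_ fv0 nu (phi, tau)))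
                 (p_ fv0 nu (contragredient rho g phi, tau))).
Proof.
split=> [p g [[phi tau] Tth pE]|g phi tau]; last exact: gmeas_p_.
have [Tth' pE'] := gmeas_p_ fv0 g nu_relinv Tth.
(* [p] is known only on Borel sets, so it is compared with its model at the preimage of [B], which
   is again Borel. *)
exists (contragredient rho g phi, tau) => // B mB; rewrite -pE'//.
by apply: pE; exact: gact_preimage_measurable.
Qed.
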